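(* For every $n,m\in\mathbb{N}$ (with $n,m\ge 1$), the higher dimensional Brin–Thompson group $nV$ embeds as a subgroup into $mV$ if and only if $n\le m$.
   Context: Let $X=\{0,1\}^{\mathbb{N}}$. The group $nV$ is the group of all homeomorphisms $g$ of $X^n$ for which there exist two partitions of $X^n$ into the same finite number $\ell$ of rectangles $v_i^{1}X\times\cdots\times v_i^{n}X$ and $w_i^{1}X\times\cdots\times w_i^{n}X$, $1\le i\le \ell$ (where $v_i^j,w_i^j$ are finite binary words and $wX$ is the set of sequences with prefix $w$), such that $g(v_i^{1}x^1,\dots,v_i^{n}x^n)=(w_i^{1}x^1,\dots,w_i^{n}x^n)$ for every $i$ and all $x^1,\dots,x^n\in X$. Equivalently, $nV$ is the topological full group of the product of $n$ copies of the groupoid of germs generated by the one-sided full shift on $\{0,1\}^{\mathbb{N}}$. *)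

(* Defs.v *)
From HB Require Import structures.
From mathcomp Require Import all_boot.
From mathcomp Require Import boolp classical_sets functions topology cantor.

Set Implicit Arguments.
Unset Strict Implicit.
Unset Printing Implicit Defensive.

Local Open Scope classical_set_scope.

Record homeo (T : topologicalType) := Homeo {
  homeo_fun :> T -> T;
  homeo_inv : T -> T;
  homeo_funK : cancel homeo_fun homeo_inv;
  homeo_invK : cancel homeo_inv homeo_fun;
  homeo_fun_continuous : continuous homeo_fun;
  homeo_inv_continuous : continuous homeo_inv }.

Section HomeoGroup.
Variable T : topologicalType.
Implicit Types g h : homeo T.

Lemma homeoP g h : homeo_fun g =1 homeo_fun h -> g = h.
Proof.
case: g h => [f f' fK f'K cf cf'] [k k' kK k'K ck ck'] /= /funext efk.
subst k; have e : f' = k' by apply/funext => x; rewrite -{1}(k'K x) fK.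
by subst k'; congr Homeo; exact: Prop_irrelevance.
Qed.

HB.instance Definition _ := gen_eqMixin (homeo T).
HB.instance Definition _ := gen_choiceMixin (homeo T).

Definition homeo_one : homeo T :=
  @Homeo T id id (fun=> erefl) (fun=> erefl) (fun _ _ => id) (fun _ _ => id).

Definition homeo_symm g : homeo T :=
  Homeo (@homeo_invK _ g) (@homeo_funK _ g)
    (@homeo_inv_continuous _ g) (@homeo_fun_continuous _ g).

Lemma homeo_comp_continuous (f k : T -> T) :
  continuous f -> continuous k -> continuous (f \o k).
Proof. by move=> cf ck x; apply: continuous_comp; [exact: ck|exact: cf]. Qed.

Definition homeo_mul g h : homeo T :=
  Homeo (can_comp (@homeo_funK _ g) (@homeo_funK _ h))
    (can_comp (@homeo_invK _ h) (@homeo_invK _ g))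
    (homeo_comp_continuous (@homeo_fun_continuous _ g)
       (@homeo_fun_continuous _ h))
    (homeo_comp_continuous (@homeo_inv_continuous _ h)
       (@homeo_inv_continuous _ g)).

Lemma homeo_mulA : associative homeo_mul.
Proof. by move=> f g h; exact: homeoP. Qed.

Lemma homeo_mul1g : left_id homeo_one homeo_mul.
Proof. by move=> g; exact: homeoP. Qed.

Lemma homeo_mulg1 : right_id homeo_one homeo_mul.
Proof. by move=> g; exact: homeoP. Qed.

Lemma homeo_mulVg : left_inverse homeo_one homeo_symm homeo_mul.
Proof. by move=> g; apply: homeoP => x; exact: homeo_funK. Qed.

Lemma homeo_mulgV : right_inverse homeo_one homeo_symm homeo_mul.
Proof. by move=> g; apply: homeoP => x; exact: homeo_invK. Qed.

HB.instance Definition _ := isGroup.Build (homeo T)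
  homeo_mulA homeo_mul1g homeo_mulg1 homeo_mulVg homeo_mulgV.

End HomeoGroup.

Definition prepend (w : seq bool) (x : cantor_space) : cantor_space :=
  fun k => if (k < size w)%N then nth false w k else x (k - size w)%N.

Definition cantor_cube (n : nat) : topologicalType :=
  prod_topology (fun _ : 'I_n => cantor_space).

Definition prepends n (v : 'I_n -> seq bool) (x : cantor_cube n) :
  cantor_cube n := fun j => prepend (v j) (x j).

Definition cylinder (w : seq bool) : set cantor_space := range (prepend w).

Definition rectangle n (v : 'I_n -> seq bool) : set (cantor_cube n) :=
  [set x | forall j, cylinder (v j) (x j)].

Definition is_brin_thompson n (g : homeo (cantor_cube n)) : Prop :=
  exists l (v w : 'I_l -> 'I_n -> seq bool),
    [/\ partition [set: 'I_l] (fun i => rectangle (v i)) [set: cantor_cube n],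
        partition [set: 'I_l] (fun i => rectangle (w i)) [set: cantor_cube n]
      & forall i x, g (prepends (v i) x) = prepends (w i) x].

Definition brin_thompson_pred n : {pred homeo (cantor_cube n)} :=
  [pred g | `[< is_brin_thompson g >]].

Section Closure.

Lemma prepend_cat (u w : seq bool) x :
  prepend (u ++ w) x = prepend u (prepend w x).
Proof.
apply/funext => k; rewrite /prepend size_cat nth_cat.
case: ltnP => [h1|h1]; case: ltnP => [h2|h2]; rewrite ?ltn_subLR //.
- by rewrite h1.
- by move: h1; rewrite leqNgt ltn_addr.
- by rewrite ltnNge h1 /= subnDA.
Qed.

Lemma prepend_inj w : injective (prepend w).
Proof.
move=> x y e; apply/funext => k.
by have := congr1 (@^~ (size w + k)) e; rewrite /prepend ltnNge leq_addr addKn.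
Qed.

Lemma prefix_eq_prepend (w v : seq bool) y z :
  prepend w y = prepend v z -> (size w <= size v)%N -> prefix w v.
Proof.
move=> e h; rewrite prefixE; apply/eqP.
apply: (@eq_from_nth _ false); first by rewrite size_takel.
move=> k; rewrite size_takel // => kw; rewrite nth_take //.
by have := congr1 (@^~ k) e; rewrite /prepend kw (leq_trans kw h).
Qed.

Definition comparable_words (w v : seq bool) := prefix w v || prefix v w.

Lemma prepend_eq (w v : seq bool) y z : prepend w y = prepend v z ->
  comparable_words w v /\ exists t, y = prepend (drop (size w) v) t.
Proof.
move=> e; case/orP: (leq_total (size w) (size v)) => h.
- have p := prefix_eq_prepend e h; split; first by rewrite /comparable_words p.
  case/prefixP: p e => s -> e; exists z; rewrite drop_size_cat //.
  by apply: (@prepend_inj w); rewrite -prepend_cat.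
- have p := prefix_eq_prepend (esym e) h.
  split; first by rewrite /comparable_words p orbT.
  by exists y; rewrite drop_oversize //; apply/funext => k;
    rewrite /prepend /= subn0.
Qed.

Lemma comparable_drop (w v : seq bool) : comparable_words w v ->
  w ++ drop (size w) v = v ++ drop (size v) w.
Proof.
by case/orP => /prefixP[s ->]; rewrite drop_size_cat // drop_oversize ?cats0 //
  size_cat leq_addr.
Qed.

Variable n : nat.
Implicit Types (g h : homeo (cantor_cube n)) (u v w : 'I_n -> seq bool).

Lemma rectangleP v x : rectangle v x <-> exists y, x = prepends v y.
Proof.
split=> [vx|[y ->] j]; last by exists (y j).
have /choice[y yE] : forall j, exists y, prepend (v j) y = x j.
  by move=> j; case: (vx j) => y _ <-; exists y.
by exists y; apply: functional_extensionality_dep => j; rewrite /prepends yE.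
Qed.

Lemma rectangle_nonempty v : rectangle v !=set0.
Proof.
pose y : cantor_cube n := fun _ _ => false.
by exists (prepends v y); apply/rectangleP; exists y.
Qed.

Lemma partitionP l (v : 'I_l -> 'I_n -> seq bool) :
  partition [set: 'I_l] (fun i => rectangle (v i)) [set: cantor_cube n] <->
  (forall x, exists i, rectangle (v i) x) /\
  (forall i k x, rectangle (v i) x -> rectangle (v k) x -> i = k).
Proof.
split=> [[cov triv _]|[cov triv]].
  split=> [x|i k x vi vk]; last by apply: triv => //; exists x.
  have : [set: cantor_cube n] x by [].
  by rewrite -cov => -[i _ vx]; exists i.
split; last by move=> i _; exact: rectangle_nonempty.
- by apply/seteqP; split=> // x _; case: (cov x) => i vx; exists i.
- by move=> i k _ _ [x [vi vk]]; exact: triv vi vk.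
Qed.

Lemma is_brin_thompson_fin (I : finType) (v w : I -> 'I_n -> seq bool) g :
    (forall x, exists i, rectangle (v i) x) ->
    (forall i k x, rectangle (v i) x -> rectangle (v k) x -> i = k) ->
    (forall i x, g (prepends (v i) x) = prepends (w i) x) ->
  is_brin_thompson g.
Proof.
move=> cov triv gE; have vw i x : rectangle (w i) (g x) -> rectangle (v i) x.
  move=> /rectangleP[y gx]; apply/rectangleP; exists y.
  by apply: (can_inj (@homeo_funK _ g)); rewrite gE.
exists #|I|, (fun i => v (enum_val i)), (fun i => w (enum_val i)); split.
- apply/partitionP; split=> [x|i k x vi vk].
    by case: (cov x) => i vx; exists (enum_rank i); rewrite enum_rankK.
  by apply: enum_val_inj; exact: triv vi vk.
- apply/partitionP; split=> [x|i k x].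
    case: (cov (homeo_inv g x)) => i /rectangleP[y gx].
    exists (enum_rank i); rewrite enum_rankK; apply/rectangleP; exists y.
    by rewrite -gE -gx homeo_invK.
  rewrite -(@homeo_invK _ g x) => /vw vi /vw vk.
  by apply: enum_val_inj; exact: triv vi vk.
- by move=> i x; rewrite gE.
Qed.

Lemma is_brin_thompson1 : is_brin_thompson (homeo_one (cantor_cube n)).
Proof.
have e (x : cantor_cube n) : prepends (fun=> [::]) x = x.
  apply: functional_extensionality_dep => j; apply/funext => k.
  by rewrite /prepends /prepend /= subn0.
apply: (@is_brin_thompson_fin unit (fun=> fun=> [::]) (fun=> fun=> [::])) => //.
- by move=> x; exists tt; apply/rectangleP; exists x; rewrite e.
- by case; case.
Qed.

Lemma is_brin_thompsonV g : is_brin_thompson g -> is_brin_thompson (homeo_symm g).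
Proof.
move=> [l [v [w [pv pw gE]]]]; exists l, w, v; split=> // i x.
by rewrite -gE /= homeo_funK.
Qed.

Lemma is_brin_thompsonM g h :
  is_brin_thompson g -> is_brin_thompson h -> is_brin_thompson (homeo_mul g h).
Proof.
move=> [l [v [w [/partitionP[covg trivg] _ gE]]]].
move=> [l' [v' [w' [/partitionP[covh trivh] _ hE]]]].
pose compat (p : 'I_l' * 'I_l) :=
  [forall j, comparable_words (w' p.1 j) (v p.2 j)].
pose a (p : {p | compat p}) j :=
  v' (val p).1 j ++ drop (size (w' (val p).1 j)) (v (val p).2 j).
pose b (p : {p | compat p}) j :=
  w (val p).2 j ++ drop (size (v (val p).2 j)) (w' (val p).1 j).
have catE (u s : 'I_n -> seq bool) x :
    prepends (fun j => u j ++ s j) x = prepends u (prepends s x).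
  by apply: functional_extensionality_dep => j; rewrite /prepends prepend_cat.
have haE p x : h (prepends (a p) x) = prepends (v (val p).2)
    (prepends (fun j => drop (size (v (val p).2 j)) (w' (val p).1 j)) x).
  rewrite catE hE -!catE; apply: functional_extensionality_dep => j.
  rewrite /prepends comparable_drop //.
  by have /forallP := valP p; apply.
apply: (@is_brin_thompson_fin {p | compat p} a b).
- move=> x; case: (covh x) => i /rectangleP[y xE].
  case: (covg (h x)) => k /rectangleP[z hxE].
  have hyz j : prepend (w' i j) (y j) = prepend (v k j) (z j).
    by have := congr1 (@^~ j) hxE; rewrite xE hE.
  have ck : compat (i, k).
    by apply/forallP => j; case: (prepend_eq (hyz j)).
  have /choice[t tE] : forall j, exists t,
      y j = prepend (drop (size (w' i j)) (v k j)) t.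
    by move=> j; case: (prepend_eq (hyz j)).
  exists (exist _ (i, k) ck); apply/rectangleP; exists t.
  rewrite catE /= xE; congr prepends.
  by apply: functional_extensionality_dep => j; rewrite tE.
- move=> p q x /rectangleP[y xp] /rectangleP[z xq].
  have e1 : (val p).1 = (val q).1.
    by apply: (trivh _ _ x); apply/rectangleP;
      [rewrite xp catE|rewrite xq catE]; eexists.
  have e2 : (val p).2 = (val q).2.
    by apply: (trivg _ _ (h x)); apply/rectangleP;
      [rewrite xp haE|rewrite xq haE]; eexists.
  by apply: val_inj; case: (val p) (val q) e1 e2 => [? ?] [? ?] /= -> ->.
- by move=> p x /=; rewrite haE gE -catE.
Qed.

Lemma brin_thompson_group_closed : group_closed (@brin_thompson_pred n).
Proof.
split; first exact/asboolP/is_brin_thompson1.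
move=> g h /asboolP btg /asboolP bth; apply/asboolP.
exact: is_brin_thompsonM btg (is_brin_thompsonV bth).
Qed.

End Closure.

Record brin_thompson n := BrinThompson {
  bt_val :> homeo (cantor_cube n);
  _ : bt_val \in @brin_thompson_pred n }.

HB.instance Definition _ n := [isSub for @bt_val n].
HB.instance Definition _ n := [Choice of brin_thompson n by <:].
HB.instance Definition _ n :=
  SubChoice_isSubGroup.Build (homeo (cantor_cube n)) (@brin_thompson_pred n)
    (brin_thompson n) (@brin_thompson_group_closed n).

(* Main.v *)
Require Import Defs.
From HB Require Import structures.
From mathcomp Require Import boolp classical_sets functions topology cantor.
From mathcomp Require Import all_boot all_order all_algebra all_fingroup.
From mathcomp Require Import all_solvable zify.

(** If n <= m, then nV acts on the first n coordinates of the m-cube, which is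
an embedding into mV ([extend_brin_thompson]).

For the converse, let f be an injective morphism from nV to mV with m < n, and
let nV contain the lattice Z^n generated by the n elements which act on one
coordinate by a hyperbolic element of V ([translation]). This lattice has a
wandering open set W ([core]): its translates are pairwise disjoint. The
contradiction comes from two facts.

A lattice of rank larger than m cannot act freely on an orbit of mV, and this
holds uniformly ([grid_orbit_collision]): there is L such that for every point
y of the m-cube two distinct elements e, e' of the box [0, L]^n satisfy
f(e) y = f(e') y. Indeed an element of mV has at each point a germ v x -> w x,
whose scaling |w| - |v| in Z^m is a cocycle. Along the orbit of y the scaling
is a Lipschitz map from the grid to Z^m, and the points of the orbit reached by
a path along which the scaling stays in a fixed box are boundedly many, because
they have a common tail and differ in a prefix of bounded length. It remains to
find long paths of this kind, which is a matter of dimension: as n > m,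
Z^m is covered by n families of separated boxes of bounded size, and if the grid
of dimension n is coloured by n colours, then some colour k has a component
joining the two faces orthogonal to the k-th direction. The latter follows from
[common_outer_boundary], a discrete form of the Poincare-Miranda theorem.

Let K be a finite p-group supported in W, and s_i fewer than p elements such that
W and its translates by s_i and by the inverse of s_i are disjoint. If H is a group
which for each k in K contains the conjugate by k of some s_i, then H contains the
derived subgroup of K ([der1_sub_of_displacement]). By the collisions above,
this applies to the stabilizer H of every point y, where the s_i are the
differences of the elements of the box [0, L]^n and do not depend on y. So, for K
extraspecial of order p^3, the derived subgroup of f(K) fixes every point, against
the injectivity of f. *)

Set Implicit Arguments.
Unset Strict Implicit.
Unset Printing Implicit Defensive.

Import Order.TTheory GRing.Theory Num.Theory.

(** * Separating sets in the integer lattice *)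

(** The cells of the cubical complex on Z^d are encoded by integer vectors: the
coordinate 2a stands for the point a, and 2a + 1 for the interval [a, a + 1]. So
the dimension of a cell is its number of odd coordinates, and boolean functions
are chains with coefficients modulo 2, possibly infinite. *)
Section CubicalChains.
Variables (d : nat).
Implicit Types (c x w : 'I_d -> int) (Z : ('I_d -> int) -> bool).

Definition oddz (z : int) := odd `|z|%N.

Definition shift (i : 'I_d) (t : int) c : 'I_d -> int :=
  fun j => if j == i then (c j + t)%R else c j.

(** The cofaces of a cell are obtained by moving an even coordinate by one, and
a chain is evaluated on all of them. *)
Definition boundary Z c : bool :=
  \big[addb/false]_(i < d | ~~ oddz (c i))
    (Z (shift i 1 c) (+) Z (shift i (- 1) c)).

Lemma oddzD1 z : oddz (z + 1)%R = ~~ oddz z.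
Proof. by rewrite /oddz; lia. Qed.

Lemma oddzB1 z : oddz (z - 1)%R = ~~ oddz z.
Proof. by rewrite /oddz; lia. Qed.

Lemma shiftC i j s t c : i != j ->
  shift i s (shift j t c) = shift j t (shift i s c).
Proof.
move=> ij; apply/funext => k; rewrite /shift.
by case: (k =P i) => [->|//]; rewrite (negPf ij).
Qed.

(** A symmetric matrix with zero diagonal has zero sum modulo 2; this is what
makes the boundary of a boundary vanish. *)
Lemma big_addb_symm (A : 'I_d -> 'I_d -> bool) :
  (forall i j, A i j = A j i) -> (forall i, A i i = false) ->
  \big[addb/false]_i \big[addb/false]_j A i j = false.
Proof.
move=> Asym A0.
pose S (P : rel 'I_d) :=
  \big[addb/false]_(i < d) \big[addb/false]_(j < d | P i j) A i j.
have -> : \big[addb/false]_(i < d) \big[addb/false]_(j < d) A i j =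
    S (fun i j => (i < j)%N) (+) S (fun i j => (j < i)%N).
  rewrite -big_split; apply: eq_bigr => i _.
  rewrite (bigID (fun j : 'I_d => (i < j)%N)) /=; congr (_ (+) _).
  rewrite [LHS](bigID (fun j : 'I_d => (j < i)%N)) /=.
  rewrite [X in _ (+) X]big1 ?addbF.
    by apply: eq_bigl => j; lia.
  by move=> j ji; have -> : j = i by apply: ord_inj; lia.
suff -> : S (fun i j => (i < j)%N) = S (fun i j => (j < i)%N) by rewrite addbb.
rewrite /S (exchange_big_dep xpredT) //=.
by apply: eq_bigr => i _; apply: eq_bigr => j _; rewrite Asym.
Qed.

Lemma boundary_boundary Z c : boundary (boundary Z) c = false.
Proof.
pose B i s j t := Z (shift j t (shift i s c)).
pose A i j := [&& i != j, ~~ oddz (c i) & ~~ oddz (c j)] &&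
  ((B i 1 j 1 (+) B i 1 j (-1))%R (+) (B i (-1) j 1 (+) B i (-1) j (-1)))%R.
rewrite -[RHS](@big_addb_symm A) => [|i j|i]; last by rewrite /A eqxx.
- rewrite /boundary big_mkcond; apply: eq_bigr => i _.
  case: ifPn => ci; last by rewrite big1 // => j _; rewrite /A (negPf ci) andbF.
  have cond t j : (t == 1 \/ t == -1)%R ->
      ~~ oddz (shift i t c j) = (i != j) && ~~ oddz (c j).
    rewrite /shift [j == i]eq_sym; case: (eqVneq i j) => //= <-.
    by case=> /eqP ->; rewrite ?oddzD1 ?oddzB1 ?ci // (negPf ci).
  rewrite !(eq_bigl _ _ (cond _ ^~ _)); last 2 first.
  - by right.
  - by left.
  rewrite -big_split /= big_mkcond; apply: eq_bigr => j _.
  by rewrite /A ci /=; case: ifP.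
- rewrite /A eq_sym; case: (eqVneq i j) => //= ij.
  rewrite [~~ oddz (c i) && _]andbC; congr (_ && _).
  by rewrite /B ![shift j _ (shift i _ c)]shiftC 1?eq_sym // addbACA.
Qed.

(** Each C k contains the half space below its k-th lower face and stays away from
the k-th upper face, so that its outer boundary is a hypersurface separating the
two faces. The hypersurfaces are intersected one after the other, and the parity
of the final zero-dimensional intersection is computed. *)
Section Separation.
Variables (L : nat) (C : 'I_d -> ('I_d -> int) -> Prop).
Hypothesis C_low : forall k x, (x k <= 0)%R -> C k x.
Hypothesis C_high : forall k x, C k x -> (x k < L)%R.

Definition touches k c : bool :=
  `[< exists2 w, C k w & forall i, (`|2 * w i - c i| <= 1)%R >].

Definition top_chain c : bool := [forall i, oddz (c i)].

(** Starting from the sum of all d-cells, the cells which touch C k are cut out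
and replaced by their boundary, for k running through s. *)
Definition sep_chain (s : seq 'I_d) : ('I_d -> int) -> bool :=
  foldl (fun Z k => boundary (fun c => touches k c && Z c)) top_chain s.

Lemma sep_chain_rcons s k : sep_chain (rcons s k) =
  boundary (fun c => touches k c && sep_chain s c).
Proof. exact: foldl_rcons. Qed.

Lemma boundary_top_chain c : boundary top_chain c = false.
Proof.
apply: big1 => i ci; suff -> : top_chain (shift i 1 c) = top_chain (shift i (-1) c).
  by rewrite addbb.
by apply: eq_forallb => j; rewrite /shift; case: eqP => // _;
  rewrite oddzD1 oddzB1.
Qed.

Lemma boundary_sep_chain s c : boundary (sep_chain s) c = false.
Proof.
case: (lastP s) => [|s' k]; first exact: boundary_top_chain.
by rewrite sep_chain_rcons boundary_boundary.
Qed.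

(** The coface of a cell contains its vertices. *)
Lemma touches_coface k c i t : (t == 1 \/ t == -1)%R -> ~~ oddz (c i) ->
  touches k c -> touches k (shift i t c).
Proof.
move=> tE ci /asboolP[w Cw wc]; apply/asboolP; exists w => // j.
have := wc j; rewrite /shift; case: eqP => // -> {j}.
by move: tE ci; rewrite /oddz; case=> /eqP ->; lia.
Qed.

Lemma boundary_witness Z c : boundary Z c ->
  exists i t, [/\ (t == 1 \/ t == -1)%R, ~~ oddz (c i) & Z (shift i t c)].
Proof.
move=> bZ; apply/not_existsP => noi; move: bZ; rewrite /boundary big1 // => i ci.
have Z0 t : (t == 1 \/ t == -1)%R -> Z (shift i t c) = false.
  by move=> tE; apply/negP => Zt; apply: (noi i); exists t.
by rewrite !Z0 //; [right|left].
Qed.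

(** A cell on the outer side of the boundary of C k: it has no vertex in C k, but
it is a face of a cell which has one. Both properties pass to faces, which is why
they survive the later cuts. *)
Definition fringe k c := ~~ touches k c /\ exists c', [/\ touches k c',
  forall i, (`|c i - c' i| <= 1)%R & forall i, oddz (c i) -> c i = c' i].

Lemma sep_chain_fringe s k c : sep_chain s c -> k \in s -> fringe k c.
Proof.
elim/last_ind: s c => // s l IH c; rewrite sep_chain_rcons => bc.
have [i [t [tE ci /andP[lt st]]]] := boundary_witness bc.
have close j : (`|c j - shift i t c j| <= 1)%R.
  by rewrite /shift; case: eqP => _; case: tE => /eqP ?; lia.
have odd_eq j : oddz (c j) -> c j = shift i t c j.
  by move=> cj; rewrite /shift; case: eqP => // e; rewrite -e cj in ci.
rewrite mem_rcons inE => /orP[/eqP ->|ks].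
  split; last by exists (shift i t c).
  (* If c itself touched C l, then so would all its cofaces, and the boundary
     could be taken before the cut, where it vanishes. *)
  apply/negP => lc; move: bc; rewrite /boundary.
  rewrite (eq_bigr (fun i => sep_chain s (shift i 1 c) (+)
                             sep_chain s (shift i (-1) c))).
    by rewrite -/(boundary _ _) boundary_sep_chain.
  by move=> j cj; rewrite !touches_coface //; [right|left].
have [nk [c' [kc' cc' oc']]] := IH _ st ks; split.
  by apply: contra nk; apply: touches_coface.
exists c'; split=> // j.
  case: (eqVneq j i) => [->|ji]; last first.
    by have := cc' j; rewrite /shift (negPf ji).
  have := oc' i; rewrite /shift eqxx => <-; first by case: tE => /eqP ->; lia.
  by case: tE => /eqP ->; rewrite ?oddzD1 ?oddzB1 ci.
move=> oj; rewrite (odd_eq _ oj); apply: oc'.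
by rewrite -odd_eq.
Qed.

Lemma touches_low k c : (c k <= 1)%R -> touches k c.
Proof.
move=> ck; apply/asboolP; exists (fun i => (c i %/ 2)%Z); last by move=> i; lia.
by apply: C_low; lia.
Qed.

Lemma touches_high k c : touches k c -> (c k < 2 * L%:Z)%R.
Proof. by move=> /asboolP[w /C_high wk /(_ k)]; lia. Qed.

Lemma fringe_range k c : fringe k c -> (1 < c k <= 2 * L%:Z)%R.
Proof.
move=> [nk [c' [/touches_high c'k /(_ k) cc' _]]].
have : ~~ (c k <= 1)%R by apply: contra nk; exact: touches_low.
lia.
Qed.

(** The intersection number of a chain with a plane parallel to the directions
in s: its other coordinates are fixed at the interval from -1 to 0, whose
end 0 lies in every C k. The indices h of the points of the plane are normalized to be
zero in the directions outside s, so that each point is counted once. *)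
Definition section_cell (s : seq 'I_d) (h : {ffun 'I_d -> 'I_L.+1}) : 'I_d -> int :=
  fun i => if i \in s then (2 * (h i)%:Z)%R else (- 1)%R.

Definition section_index (s : seq 'I_d) : pred {ffun 'I_d -> 'I_L.+1} :=
  fun h => [forall i, (i \in s) || (h i == ord0)].

Definition section_parity s Z :=
  \big[addb/false]_(h | section_index s h) Z (section_cell s h).

(** Pairing the upper face of each cell with the lower face of the next one is a
reindexing of the sum once the k-th coordinate is made cyclic. *)
Definition rotate k (h : {ffun 'I_d -> 'I_L.+1}) : {ffun 'I_d -> 'I_L.+1} :=
  [ffun i => if i == k then ordS (h i) else h i].

Lemma rotate_inj k : injective (rotate k).
Proof.
move=> h h' e; apply/ffunP => i; have := congr1 (fun f : {ffun _} => f i) e.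
by rewrite !ffunE; case: eqP => // _ /ordS_inj.
Qed.

Lemma ordS_val (a : 'I_L.+1) : ordS a = (if a == L :> nat then 0 else a.+1) :> nat.
Proof.
rewrite /=; case: eqP => [->|aL]; first by rewrite modnn.
by rewrite modn_small //; have := ltn_ord a; lia.
Qed.

Lemma section_index_rotate s k h :
  k \in s -> section_index s (rotate k h) = section_index s h.
Proof.
move=> ks; apply: eq_forallb => i; rewrite ffunE.
by case: (i =P k) => [->|]; rewrite ?ks.
Qed.

(** The telescoping sum over the k-th coordinate. *)
Lemma section_parity_face s k Z : k \in s ->
  \big[addb/false]_(h | section_index s h)
     (Z (shift k 1 (section_cell s h)) (+) Z (shift k (-1) (section_cell s h))) =
  \big[addb/false]_(h | section_index s h && (h k == 0%N :> nat))
     (Z (shift k (2 * L%:Z + 1)%R (section_cell s h)) (+)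
      Z (shift k (-1) (section_cell s h))).
Proof.
move=> ks; have cellE h t : shift k t (section_cell s (rotate k h)) =
    shift k (2 * (if h k == L :> nat then - L%:Z else 1) + t)%R (section_cell s h).
  apply/funext => i; rewrite /shift /section_cell ffunE.
  by case: (i =P k) => [->|//]; rewrite ks ordS_val; case: eqP => ?; lia.
have rot0 h : (rotate k h k == 0%N :> nat) = (h k == L :> nat).
  by rewrite ffunE eqxx ordS_val; case: (h k =P L :> nat).
rewrite big_split /= [X in _ (+) X](reindex_inj (@rotate_inj k)) /=.
rewrite [RHS](reindex_inj (@rotate_inj k)) /=.
rewrite (eq_bigl _ _ (fun h => section_index_rotate h ks)) -big_split /=.
rewrite [RHS](eq_bigl (fun h => section_index s h && (h k == L :> nat))); last first.
  by move=> h; rewrite rot0 section_index_rotate.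
rewrite [RHS]big_mkcondr /=; apply: eq_bigr => h _.
rewrite !cellE; case: eqP => _; last first.
  by rewrite mulr1 (_ : (2 - 1 = 1 :> int)%R) // addbb.
by congr (Z (shift k _ _) (+) _); lia.
Qed.

(** Cutting by C k keeps the intersection number. In a direction i of s the cut
chain is bounded by [fringe_range], so that the telescoping sum vanishes. In the
direction k only the lower end remains: there all cells touch C k, and the
sum is the previous intersection number. *)
Lemma section_parity_rcons s k : k \notin s ->
  section_parity (rcons s k) (sep_chain (rcons s k)) =
  section_parity s (sep_chain s).
Proof.
move=> ks; rewrite sep_chain_rcons /section_parity.
set s' := rcons s k; set Z := fun c => touches k c && sep_chain s c.
have odd_cell h i : ~~ oddz (section_cell s' h i) = (i \in s').
  by rewrite /section_cell; case: ifP => //=; rewrite /oddz; lia.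
transitivity (\big[addb/false]_(h | section_index s' h)
  \big[addb/false]_(i < d | i \in s') (Z (shift i 1 (section_cell s' h)) (+)
                                       Z (shift i (-1) (section_cell s' h)))).
  by apply: eq_bigr => h _; apply: eq_bigl => i; rewrite odd_cell.
rewrite exchange_big /=.
have ks' : k \in s' by rewrite mem_rcons mem_head.
rewrite (bigD1 k) //= [X in _ (+) X]big1 ?addbF => [|i /andP[is' ik]]; last first.
  rewrite section_parity_face // big1 // => h /andP[_ /eqP hi].
  have is_ : i \in s by move: is'; rewrite mem_rcons inE (negPf ik).
  have Z0 t : (t == -1 \/ t == 2 * L%:Z + 1)%R -> Z (shift i t (section_cell s' h)) = false.
    move=> tE; apply/negP => /andP[_ /sep_chain_fringe/(_ is_)/fringe_range].
    rewrite /shift eqxx /section_cell is' hi.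
    by case: tE => /eqP ->; lia.
  by rewrite !Z0 //; [left|right].
rewrite section_parity_face //.
rewrite [RHS](eq_bigl (fun h => section_index s' h && (h k == 0%N :> nat))).
  apply: eq_bigr => h /andP[_ /eqP hk].
  have -> : shift k (-1) (section_cell s' h) = section_cell s h.
    apply/funext => i; rewrite /shift /section_cell mem_rcons inE.
    by case: eqP => [->|//] /=; rewrite hk (negPf ks).
  have -> : Z (shift k (2 * L%:Z + 1)%R (section_cell s' h)) = false.
    apply/negP => /andP[/touches_high + _].
    by rewrite /shift eqxx /section_cell ks' hk; lia.
  by rewrite /Z touches_low // /section_cell (negPf ks).
move=> h; rewrite /section_index.
apply/forallP/andP => [hs|[/forallP hs /eqP hk] i].
  split; last by have := hs k; rewrite (negPf ks) /= => /eqP ->.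
  by apply/forallP => i; rewrite mem_rcons inE; case/orP: (hs i) => ->; rewrite ?orbT.
have := hs i; rewrite mem_rcons inE -orbA => /orP[/eqP ->|//].
by apply/orP; right; apply/eqP/ord_inj.
Qed.

Lemma section_parity1 s : uniq s -> section_parity s (sep_chain s) = true.
Proof.
elim/last_ind: s => [_|s k IH]; last first.
  by rewrite rcons_uniq => /andP[ks us]; rewrite section_parity_rcons ?IH.
rewrite /section_parity (big_pred1 [ffun=> ord0]) => [|h /=].
  by apply/forallP => i.
apply/forallP/eqP => [h0|-> i]; last by rewrite ffunE.
by apply/ffunP => i; rewrite ffunE; apply/eqP; exact: h0.
Qed.

(** The cut by all the C k is a set of vertices, with an odd number of elements,
each in the fringe of every C k. *)
Lemma common_outer_boundary : exists v : 'I_d -> int, forall k,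
  ~ C k v /\ exists2 w, C k w & forall i, (`|v i - w i| <= 1)%R.
Proof.
have := section_parity1 (enum_uniq 'I_d); rewrite /section_parity.
case: (pickP (fun h => section_index (enum 'I_d) h &&
    sep_chain (enum 'I_d) (section_cell (enum 'I_d) h))) => [h /andP[_ hZ] _|h0].
  exists (fun i => Posz (h i)) => k.
  have [nk [c' [/asboolP[w Cw wc'] cc' _]]] := sep_chain_fringe hZ (mem_enum _ k).
  split.
    apply: contraNnot nk => Ck; apply/asboolP; exists (fun i => Posz (h i)) => // i.
    by rewrite /section_cell mem_enum /=; lia.
  exists w => // i; have := wc' i; have := cc' i.
  by rewrite /section_cell mem_enum /=; lia.
rewrite big1 // => h hs; have := h0 h.
by rewrite /= hs.
Qed.

End Separation.
End CubicalChains.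

(** * Prefix replacement maps *)

Lemma brin_thompsonM_apply n (g h : brin_thompson n) x : (g * h)%g x = g (h x).
Proof. by []. Qed.

Lemma brin_thompsonP n (g : brin_thompson n) : is_brin_thompson g.
Proof. by case: g => g gP; exact/asboolP. Qed.

Lemma prepends_cat n (v s : 'I_n -> seq bool) x :
  prepends (fun j => v j ++ s j) x = prepends v (prepends s x).
Proof. by apply: functional_extensionality_dep => j; rewrite /prepends prepend_cat. Qed.

(** Two boxes which meet have a common refinement. *)
Lemma prepends_eq n (v v' : 'I_n -> seq bool) y y' : prepends v y = prepends v' y' ->
  exists s s', (forall j, v j ++ s j = v' j ++ s' j) /\ exists z, y = prepends s z.
Proof.
move=> e; exists (fun j => drop (size (v j)) (v' j)), (fun j => drop (size (v' j)) (v j)).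
have ej j : prepend (v j) (y j) = prepend (v' j) (y' j) := congr1 (@^~ j) e.
split; first by move=> j; apply: comparable_drop; case: (prepend_eq (ej j)).
have /choice[z zE] : forall j, exists z, y j = prepend (drop (size (v j)) (v' j)) z.
  by move=> j; case: (prepend_eq (ej j)).
by exists z; apply: functional_extensionality_dep => j; rewrite zE.
Qed.

(** If u were shorter than w = u b s, a sequence beginning with the other letter
than b would tell them apart. *)
Lemma eq_prepend_size u w : prepend u =1 prepend w -> size u = size w.
Proof.
wlog lt : u w / (size u < size w)%N => [th e|e].
  case: (ltngtP (size u) (size w)) => // lt; first exact: th.
  by apply/esym/th => // x; rewrite e.
have p := prefix_eq_prepend (e (fun=> false)) (ltnW lt).
case/prefixP: p e lt => [[|b s]] ->; rewrite ?cats0 ?ltnn // => e _.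
have := e (fun=> ~~ b); rewrite prepend_cat => /(@prepend_inj u)/(congr1 (@^~ 0%N)).
by rewrite /prepend /=; case: b {e}.
Qed.

Lemma brin_thompson_ext n (g h : brin_thompson n) : g =1 h -> g = h.
Proof. by move=> gh; apply/val_inj/homeoP. Qed.

Lemma brin_thompsonK n (g : brin_thompson n) : cancel g (g^-1)%g.
Proof. by move=> x; rewrite -brin_thompsonM_apply mulVg. Qed.

Lemma brin_thompsonVK n (g : brin_thompson n) : cancel (g^-1)%g g.
Proof. by move=> x; rewrite -brin_thompsonM_apply mulgV. Qed.

Definition tail n (x : cantor_space) : cantor_space := fun i => x (n + i)%N.

Lemma tail_prepend k (u : seq bool) z : (size u <= k)%N ->
  tail k (prepend u z) = tail (k - size u) z.
Proof.
move=> le; apply/funext => i; rewrite /tail /prepend ltnNge.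
by rewrite (leq_trans le) ?leq_addr //= addnBAC.
Qed.

Definition window k (x : cantor_space) : seq bool := mkseq x k.

Lemma prepend_window k x : prepend (window k x) (tail k x) = x.
Proof.
apply/funext => i; rewrite /prepend /tail size_mkseq.
by case: ltnP => [ik|/subnKC -> //]; rewrite nth_mkseq.
Qed.

Lemma eq_window k (x z : cantor_space) :
  (forall i, (i < k)%N -> z i = x i) -> window k z = window k x.
Proof.
move=> e; apply: (@eq_from_nth _ false) => [|i]; rewrite ?size_mkseq // => ik.
by rewrite !nth_mkseq ?e.
Qed.

Lemma tail_prepend_size u x : tail (size u) (prepend u x) = x.
Proof. by rewrite tail_prepend // subnn. Qed.

Lemma tail_prepend_drop k u x : (k <= size u)%N ->
  tail k (prepend u x) = prepend (drop k u) x.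
Proof.
move=> ku; have := tail_prepend_size (take k u) (prepend (drop k u) x).
by rewrite -prepend_cat cat_take_drop size_takel.
Qed.

Lemma window_prepend k u x : (k <= size u)%N -> window k (prepend u x) = take k u.
Proof.
move=> ku; apply: (@eq_from_nth _ false) => [|i]; rewrite size_mkseq ?size_takel // => ik.
by rewrite nth_mkseq // nth_take // /prepend (leq_trans ik ku).
Qed.

Section PrefixMapTopology.
Local Open Scope classical_set_scope.

Lemma cvg_prod_topology (I : Type) (K : I -> topologicalType)
    (F : set_system (prod_topology K)) (f : prod_topology K) : Filter F ->
  (forall i, (fun g : prod_topology K => g i) @ F --> f i) -> F --> f.
Proof.
move=> FF Ff; apply/cvg_sup => i A [B [[C oC <-] Cf] sBA].
apply: filterS sBA _; apply: (Ff i); exact: open_nbhs_nbhs.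
Qed.

Lemma near_prefix n M (x : cantor_cube n) :
  \forall z \near x, forall j i, (i < M)%N -> z j i = x j i.
Proof.
have bit j i : \forall z \near x, z j i = x j i.
  have : (fun z : cantor_cube n => z j i) @ x --> x j i.
    apply: (@cvg_comp _ _ _ (fun z : cantor_cube n => z j) (fun z : cantor_space => z i)).
      exact: (@proj_continuous _ (fun=> cantor_space) j x).
    exact: (@proj_continuous _ (fun=> bool) i (x j)).
  by move=> /discrete_cvg.
have : \forall z \near x, forall p : 'I_n * 'I_M, (z : cantor_cube n) p.1 p.2 = x p.1 p.2.
  refine (@filter_forall (cantor_cube n) ('I_n * 'I_M)%type
    (fun p (z : cantor_cube n) => z p.1 p.2 = x p.1 p.2) (nbhs x) _ _).
  by move=> p; exact: bit.
by apply: filterS => z zx j i iM; exact: (zx (j, Ordinal iM)).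
Qed.

Section LocalTables.
Variable n : nat.
Local Notation cube := (cantor_cube n).

(** Uniform tables: all the prefixes of length at least D are replaced. They are
easier to compose and to restrict than tables over a partition, and define the
same homeomorphisms. *)
Definition prefix_map D (f : cube -> cube) := forall v : 'I_n -> seq bool,
  (forall j, (D <= size (v j))%N) -> exists w, forall y, f (prepends v y) = prepends w y.

Lemma prepends_window k (x : cube) :
  prepends (fun j => window k (x j)) (fun j => tail k (x j)) = x.
Proof.
by apply: functional_extensionality_dep => j; rewrite /prepends prepend_window.
Qed.

Lemma prefix_map_continuous D f : prefix_map D f -> continuous f.
Proof.
move=> fD x; apply: cvg_prod_topology => j; apply: (@cvg_prod_topology nat (fun=> bool)) => k.
apply/discrete_cvg; have := near_prefix (D + k.+1) x; apply: filterS => z zx.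
have [|w wE] := fD (fun i => window D (x i)); first by move=> i; rewrite size_mkseq.
(* The first D letters of the coordinates are replaced by words that may be
   empty, so k.+1 further letters determine the letter k of the image. *)
have fE y : (forall i l, (l < D + k.+1)%N -> y i l = x i l) ->
    f y j k = prepend (w j ++ window k.+1 (tail D (x j))) (fun=> false) k.
  move=> yx; have -> : y = prepends (fun i => window D (x i)) (fun i => tail D (y i)).
    rewrite -[LHS](prepends_window D); apply: functional_extensionality_dep => i.
    rewrite /prepends (@eq_window D (x i) (y i)) // => l lD.
    by apply: yx; rewrite ltn_addr.
  rewrite wE /prepends prepend_cat /prepend; case: ifP => // /negbT; rewrite -leqNgt => le.
  have kk : (k - size (w j) < k.+1)%N by rewrite ltnS leq_subr.
  by rewrite size_mkseq kk nth_mkseq // /tail yx // ltn_add2l.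
by rewrite /= fE // fE.
Qed.

(** The boxes of all the words of length D form the first partition. *)
Lemma prefix_map_bt D g : prefix_map D (homeo_fun g) -> is_brin_thompson g.
Proof.
move=> gD; pose v (t : {ffun 'I_n -> D.-tuple bool}) j : seq bool := t j.
have /choice[w wE] : forall t, exists w, forall y, g (prepends (v t) y) = prepends w y.
  by move=> t; apply: gD => j; rewrite size_tuple.
apply: (@is_brin_thompson_fin _ _ v w) => // [x|t t' x].
  exists [ffun j => Tuple (introT eqP (size_mkseq (x j) D))]; apply/rectangleP.
  exists (fun j => tail D (x j)); rewrite -[LHS](prepends_window D).
  apply: functional_extensionality_dep => j; by rewrite /prepends /v ffunE.
move=> tx t'x; apply/ffunP => j; apply: val_inj => /=.
have [y _ yx] := tx j; have [y' _ yx'] := t'x j.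
have := prefix_eq_prepend (etrans yx (esym yx')); rewrite !size_tuple leqnn => /(_ isT).
by rewrite prefixE take_oversize ?size_tuple // => /eqP.
Qed.

Lemma brin_thompson_prefix_map (g : homeo cube) :
  is_brin_thompson g -> exists D, prefix_map D g.
Proof.
move=> [l [v [w [/partitionP[cov _] _ gE]]]].
exists (\max_i \max_j size (v i j))%N => u uD.
have [i /rectangleP[y uy]] := cov (prepends u (fun=> fun=> false)).
have vu j : v i j ++ drop (size (v i j)) (u j) = u j.
  have /esym/prefix_eq_prepend/(_ _) : prepend (u j) (fun=> false) = prepend (v i j) (y j).
    exact: (congr1 (@^~ j) uy).
  rewrite (leq_trans _ (uD j)); last by apply: leq_trans (leq_bigmax i); exact: (leq_bigmax j).
  by move=> /(_ isT)/prefixP[s ->]; rewrite drop_size_cat.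
exists (fun j => w i j ++ drop (size (v i j)) (u j)) => t.
rewrite prepends_cat -gE -prepends_cat; congr (g _).
by apply: functional_extensionality_dep => j; rewrite /prepends vu.
Qed.

Lemma brin_thompson_of_prefix_map D D' f f' : cancel f f' -> cancel f' f ->
  prefix_map D f -> prefix_map D' f' -> {g : brin_thompson n | g =1 f :> (cube -> cube)}.
Proof.
move=> fK f'K fD f'D.
pose g := Homeo fK f'K (prefix_map_continuous fD) (prefix_map_continuous f'D).
have gP : g \in @brin_thompson_pred n by apply/asboolP; apply: (@prefix_map_bt D).
by exists (BrinThompson gP).
Qed.

End LocalTables.

End PrefixMapTopology.

(** * Germs and the orbits of lattices in mV *)

Section Germs.
Variable m : nat.
Local Notation cube := (cantor_cube m).
Local Notation words := ('I_m -> seq bool).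
Implicit Types (f g : cube -> cube) (x y : cube) (v w : words).

(** The scaling of this germ is the vector of differences |w j| - |v j|; by the
two lemmas below it is a cocycle which depends on the map f and the point x
only. *)
Definition germ f x v w :=
  rectangle v x /\ forall z, f (prepends v z) = prepends w z.

Lemma germ_size_unique f x v w v' w' : germ f x v w -> germ f x v' w' ->
  forall j, (size (w j) + size (v' j) = size (w' j) + size (v j))%N.
Proof.
move=> gf gf' j; have [/rectangleP[y xE] fE] := gf.
have [/rectangleP[y' xE'] fE'] := gf'.
have [s [s' [ss' [z yE]]]] := prepends_eq (etrans (esym xE) xE').
have e t : prepends (fun j => w j ++ s j) t = prepends (fun j => w' j ++ s' j) t.
  rewrite !prepends_cat -fE -fE' -!prepends_cat; congr f.
  by apply: functional_extensionality_dep => i; rewrite /prepends ss'.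
have : size (w j ++ s j) = size (w' j ++ s' j).
  by apply: eq_prepend_size => t; exact: (congr1 (@^~ j) (e (fun=> t))).
have := congr1 size (ss' j); rewrite !size_cat; lia.
Qed.

Lemma germ_comp f g x v w v' w' : germ f x v w -> germ g (f x) v' w' ->
  exists v'' w'', germ (g \o f) x v'' w'' /\ forall j,
    (size (w'' j) + size (v j) + size (v' j) =
     size (v'' j) + size (w j) + size (w' j))%N.
Proof.
move=> gf gg; have [/rectangleP[y xE] fE] := gf.
have [/rectangleP[y' fxE] gE] := gg.
have /prepends_eq[s [s' [ss' [z yE]]]] : prepends w y = prepends v' y'.
  by rewrite -fxE xE fE.
exists (fun j => v j ++ s j), (fun j => w' j ++ s' j); split; last first.
  by move=> j; have := congr1 size (ss' j); rewrite !size_cat; lia.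
split; first by apply/rectangleP; exists z; rewrite prepends_cat -yE.
move=> t; rewrite /= !prepends_cat fE -gE -!prepends_cat; congr g.
by apply: functional_extensionality_dep => i; rewrite /prepends ss'.
Qed.

Lemma brin_thompson_germ (g : brin_thompson m) : exists D, forall x, exists v w,
  germ g x v w /\ forall j, (size (v j) <= D)%N /\ (size (w j) <= D)%N.
Proof.
have [l [v [w [/partitionP[cov _] _ gE]]]] := brin_thompsonP g.
exists (\max_i \max_j maxn (size (v i j)) (size (w i j)))%N => x.
have [i vx] := cov x; exists (v i), (w i); split; first by split=> // z; rewrite gE.
move=> j; apply/andP; rewrite -geq_max.
by apply: leq_trans (leq_bigmax i); exact: (leq_bigmax j).
Qed.

Lemma brin_thompson_germ_seq (S : seq (brin_thompson m)) : exists D,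
  forall a, a \in S -> forall x, exists v w,
  germ a x v w /\ forall j, (size (v j) <= D)%N /\ (size (w j) <= D)%N.
Proof.
elim: S => [|b S [D IH]]; first by exists 0%N.
have [E hE] := brin_thompson_germ b; exists (maxn D E) => a.
rewrite inE => /predU1P[->|aS] x; [have [v [w [gx le]]] := hE x|
  have [v [w [gx le]]] := IH _ aS x]; exists v, w; split=> // j; have := le j; lia.
Qed.

End Germs.

(** For each k, the integers a for which a - k D is at least D modulo d D form
intervals of length (d - 1) D, separated by gaps of length D, and the gaps for
different k are disjoint. Hence a point of Z^m lies in a gap for at most m of the
d colours, in some coordinate. *)
Lemma exists_color m d D (t : 'I_m -> int) : (m < d)%N -> (0 < D)%N ->
  exists k : 'I_d, forall j, (D%:Z <= ((t j - k%:Z * D%:Z) %% (d * D)%N%:Z)%Z)%R.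
Proof.
move=> md D0; apply/not_existsP => nok.
have /choice[c cP] : forall k : 'I_d, exists j : 'I_m,
    (((t j - k%:Z * D%:Z) %% (d * D)%N%:Z)%Z < D%:Z)%R.
  by move=> k; have /existsNP[j /negP] := nok k; rewrite -ltNge; exists j.
suff /leq_card : injective c by rewrite !card_ord leqNgt md.
move=> k k' e; apply/eqP; apply: contraT => kk'.
have := cP k; have := cP k'; rewrite e; move: (t _) => a.
wlog lt : k k' {kk' e} / (k' < k)%N => [th|].
  case: (ltngtP k k') => [lt|lt|/ord_inj ee]; last by rewrite ee eqxx in kk'.
  - by move=> h1 h2; apply: (th k' k).
  - exact: th.
have km := ltn_ord k.
set N := (d * D)%N; set b := (a - k%:Z * D%:Z)%R; set b' := (a - k'%:Z * D%:Z)%R.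
have eb : (b' = b + ((k - k') * D)%N%:Z)%R.
  by rewrite /b /b' PoszM -subzn ?(ltnW lt) //; lia.
have l1 : (D <= (k - k') * D)%N by rewrite leq_pmull // subn_gt0.
have l2 : ((k - k') * D + D <= N)%N by rewrite -mulSnr leq_mul2r; apply/orP; right; lia.
have := divz_eq b N%:Z; have := divz_eq b' N%:Z.
move: eb l1 l2; set q := (_ * D)%N => eb l1 l2.
set B' := (b' %/ _)%Z; set B := (b %/ _)%Z => e' e r' r.
have N0 : (0 < N)%N by lia.
have p1 : (0 <= (b %% N%:Z)%Z)%R by apply: modz_ge0; lia.
have p2 : (0 <= (b' %% N%:Z)%Z)%R by apply: modz_ge0; lia.
have : (B' = B \/ B' + 1 <= B \/ B + 1 <= B')%R by lia.
case=> [eB|[leB|leB]].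
- by rewrite eB in e'; lia.
- have : ((B' + 1) * N%:Z <= B * N%:Z)%R by rewrite ler_wpM2r.
  by lia.
- have : ((B + 1) * N%:Z <= B' * N%:Z)%R by rewrite ler_wpM2r.
  by lia.
Qed.

(** A step of length at most D does not jump over a gap of length D. *)
Lemma divz_eq_of_gap (D N : nat) (u u' : int) : (0 < N)%N ->
  (D%:Z <= (u %% N%:Z)%Z)%R -> (D%:Z <= (u' %% N%:Z)%Z)%R ->
  (`|u - u'| <= D%:Z)%R -> (u %/ N%:Z)%Z = (u' %/ N%:Z)%Z.
Proof.
move=> N0 h h' le; have e := divz_eq u N%:Z; have e' := divz_eq u' N%:Z.
have l : ((u %% N%:Z)%Z < N%:Z)%R by apply: ltz_pmod; lia.
have l' : ((u' %% N%:Z)%Z < N%:Z)%R by apply: ltz_pmod; lia.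
move: e e' h h' l l'; set q := (u %/ _)%Z; set q' := (u' %/ _)%Z => e e' h h' l l'.
have : (q = q' \/ q + 1 <= q' \/ q' + 1 <= q)%R by lia.
case=> [//|[lq|lq]].
- have : ((q + 1) * N%:Z <= q' * N%:Z)%R by rewrite ler_wpM2r.
  by lia.
- have : ((q' + 1) * N%:Z <= q * N%:Z)%R by rewrite ler_wpM2r.
  by lia.
Qed.

(** A family b of elements of mV indexed by a grid of dimension d > m, in which
neighbours differ by an element of a finite set, has coinciding values at
every point, within a range that depends on the family only. *)
Section Collision.
Variables (m d : nat) (b : ('I_d -> nat) -> brin_thompson m).
Hypothesis md : (m < d)%N.
Variable S : seq (brin_thompson m).
Hypothesis bS : forall e e' : 'I_d -> nat,
  (forall i, e i <= (e' i).+1 /\ e' i <= (e i).+1)%N ->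
  exists2 a, a \in S & b e' = (a * b e)%g.

(** The scaling f of the germ of b e at y moves by at most D0 between
neighbours. Vertices of colour k lie in a union of boxes of side less than
N = d D separated by more than D0, so along a path of colour k the scaling stays
in one box. The word replaced at a step is a prefix of bounded length, so the
points b e y of the path share a tail, once the scaling is subtracted
from its length; this tail is the invariant inv. The missing prefix has at most
D + N letters, which bounds the number of points by the cardinal of code_type. *)
Lemma grid_orbit_collision : exists L, forall y : cantor_cube m,
  exists e e' : 'I_d -> nat,
    [/\ forall i, (e i <= L)%N, forall i, (e' i <= L)%N, e <> e' &
        b e y = b e' y].
Proof.
have [D0 hD0] := brin_thompson_germ_seq S.
pose D := D0.+1; pose N := (d * D)%N.
pose code_type := {ffun 'I_m -> {ffun 'I_(D + N) -> bool} * 'I_N}.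
pose L := #|{: code_type}|.+1; exists L => y.
have N0 : (0 < N)%N by rewrite muln_gt0 /= andbT (leq_trans _ md).
have /choice[VW VWP] : forall e, exists VW : ('I_m -> seq bool) * ('I_m -> seq bool),
    germ (b e) y VW.1 VW.2.
  move=> e; have [? h] := brin_thompson_germ (b e).
  by have [v [w [g _]]] := h y; exists (v, w).
pose f e j : int := ((size ((VW e).2 j))%:Z - (size ((VW e).1 j))%:Z)%R.
have step e e' : (forall i, e i <= (e' i).+1 /\ e' i <= (e i).+1)%N ->
    forall j, (`|f e j - f e' j| <= D0%:Z)%R /\
      forall k k' : nat, (D0 <= k)%N -> (D0 <= k')%N -> (k'%:Z - k%:Z = f e' j - f e j)%R ->
        tail k (b e y j) = tail k' (b e' y j).
  move=> adj j; have [a aS be'] := bS adj.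
  have [v [w [ga /(_ j)[sv sw]]]] := hD0 a aS (b e y).
  have [v2 [w2 [gc sz]]] := germ_comp (VWP e) ga.
  have u := germ_size_unique (VWP e').
  have {u} := u v2 w2 _ j; rewrite be' => /(_ gc) uj.
  have fE : (f e' j - f e j = (size (w j))%:Z - (size (v j))%:Z)%R.
    by rewrite /f; have := sz j; lia.
  split; first lia.
  move=> k k' Dk Dk' kk'; rewrite brin_thompsonM_apply.
  have [/rectangleP[z ->] ->] := ga.
  rewrite /prepends !tail_prepend; [|lia..].
  by have -> : (k - size (v j) = k' - size (w j))%N by lia.
(* From here on the points b e y with e in the box [0, L]^d are pairwise distinct;
   the path that contradicts this is found among them. *)
apply: contrapT => nocol.
have inj e e' : (forall i, e i <= L)%N -> (forall i, e' i <= L)%N ->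
    b e y = b e' y -> e = e'.
  by move=> eL e'L h; apply: contrapT => ne; apply: nocol; exists e, e'.
(* The retraction of Z^d onto the box keeps neighbours neighbours. *)
pose cl (x : 'I_d -> int) i : nat := if (x i < 0)%R then 0%N else minn `|x i| L.
pose adj (x x' : 'I_d -> int) := forall i, (`|x i - x' i| <= 1)%R.
have clS x x' : adj x x' -> forall i, (cl x i <= (cl x' i).+1 /\ cl x' i <= (cl x i).+1)%N.
  by move=> xx' i; have := xx' i; rewrite /cl; case: ifP; case: ifP; lia.
have clL x i : (cl x i <= L)%N by rewrite /cl; case: ifP; lia.
(* The position of the scaling inside its interval of colour k. *)
pose res (k : 'I_d) x j := ((f (cl x) j - k%:Z * D%:Z) %% N%:Z)%Z.
have /choice[col colP] : forall x, exists k, forall j, (D%:Z <= res k x j)%R.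
  by move=> x; apply: exists_color.
have resN k x j : (0 <= res k x j < N%:Z)%R.
  by rewrite modz_ge0 ?ltz_pmod //; lia.
pose resn k x j := `|res k x j|%N.
pose inv k x j := tail (D + resn k x j) (b (cl x) y j).
have invS k x x' : adj x x' -> col x = k -> col x' = k -> inv k x = inv k x'.
  move=> xx' xk x'k; apply: functional_extensionality_dep => j.
  have [Df tE] := step _ _ (clS _ _ xx') j.
  have q : ((f (cl x) j - k%:Z * D%:Z) %/ N%:Z)%Z = ((f (cl x') j - k%:Z * D%:Z) %/ N%:Z)%Z.
    apply: (@divz_eq_of_gap D) => //; first by have := colP x j; rewrite xk.
      by have := colP x' j; rewrite x'k.
    by move: Df; lia.
  apply: tE; [lia | lia |].
  have := divz_eq (f (cl x) j - k%:Z * D%:Z) N%:Z.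
  have := divz_eq (f (cl x') j - k%:Z * D%:Z) N%:Z.
  rewrite -q -/(res k x j) -/(res k x' j).
  have := resN k x j; have := resN k x' j; rewrite /resn.
  by set QN := (divz _ _ * N%:Z)%R; lia.
(* Instead of the component of colour k of the lower face, its trace is recorded:
   one vertex of the same colour and tail for each height t up to that of x. *)
pose C (k : 'I_d) x := (x k <= 0)%R \/ col x = k /\
  forall t : nat, (0 < t)%N -> (Posz t <= x k)%R ->
    exists z, [/\ col z = k, inv k z = inv k x & z k = Posz t].
have resnN k x j : (resn k x j < N)%N by have := resN k x j; rewrite /resn; lia.
(* A vertex of C k at height L yields L points of the orbit with the same tail,
   more than the available codes. *)
have Chigh k x : C k x -> (x k < L)%R.
  move=> Ck; rewrite ltNge; apply/negP => Lx.
  case: Ck => [|[_ zt]]; first by move=> x0; have : (Posz L <= 0)%R by lia.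
  have /choice[z zP] : forall t : 'I_L, exists z,
      [/\ col z = k, inv k z = inv k x & z k = Posz t.+1].
    by move=> t; apply: zt => //; have := ltn_ord t; lia.
  pose code (t : 'I_L) : code_type := [ffun j =>
    ([ffun i : 'I_(D + N) => b (cl (z t)) y j i], Ordinal (resnN k (z t) j))].
  suff /leq_card : injective code by rewrite card_ord /L ltnn.
  move=> t t' tt'; apply: ord_inj.
  have [_ invt zt_] := zP t; have [_ invt' zt'_] := zP t'.
  suff e : cl (z t) = cl (z t').
    have := congr1 (@^~ k) e; rewrite /cl zt_ zt'_ /=.
    by have := ltn_ord t; have := ltn_ord t'; lia.
  apply: inj; [exact: clL | exact: clL |].
  apply: functional_extensionality_dep => j; apply/funext => i.
  have := congr1 (fun c : code_type => c j) tt'; rewrite !ffunE => -[bits rr].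
  have := congr1 (@^~ j) (etrans invt (esym invt')); rewrite /inv rr.
  move=> /(congr1 (@^~ (i - (D + resn k (z t') j))%N)); rewrite /tail.
  case: (leqP (D + resn k (z t') j) i) => [le|lt]; first by rewrite subnKC.
  move=> _; have iDN : (i < D + N)%N by have := resnN k (z t') j; lia.
  by have := congr1 (fun g : {ffun 'I_(D + N) -> bool} => g (Ordinal iDN)) bits;
    rewrite !ffunE.
have Clow k x : (x k <= 0)%R -> C k x by left.
have [v vP] := common_outer_boundary Clow Chigh.
(* A neighbour of C k of colour k belongs to C k. *)
have [nC [w Cw vw]] := vP (col v); apply: nC.
have vk := vw (col v).
case: Cw => [w0|[wk wt]]; right; split=> // t t0 tv.
  by exists v; split=> //; lia.
have e : inv (col v) w = inv (col v) v.
  by apply: invS => // i; have := vw i; lia.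
have [tw|tw] : ((Posz t <= w (col v)) \/ v (col v) = Posz t)%R by lia.
  by have [z [zk zi zt]] := wt t t0 tw; exists z; rewrite zi e.
by exists v.
Qed.
End Collision.

(** * Groups displaced by few elements *)

Section Displacement.
Local Open Scope group_scope.

Lemma morph_one (G G' : groupType) (f : G -> G') :
  {morph f : g h / g * h} -> f 1 = 1.
Proof. by move=> fM; apply: (@mulgI _ (f 1)); rewrite -fM !mulg1. Qed.

Lemma morph_inv (G G' : groupType) (f : G -> G') :
  {morph f : g h / g * h} -> {morph f : g / g^-1}.
Proof.
by move=> fM g; apply: (@mulgI _ (f g)); rewrite -fM !mulgV (morph_one fM).
Qed.

(** The quotients generate a subgroup containing a translate of L, hence of index
less than p; the index is a power of p. *)
Lemma gen_ldiv_of_large (gT : finGroupType) p (L : {set gT}) :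
  prime p -> p.-group [set: gT] -> #|[set: gT]| < p * #|L| ->
  <<[set g * h^-1 | g in L, h in L]>> = [set: gT].
Proof.
move=> p_pr pG ltL; set U := [set _ | _ in _, _ in _].
have [g0 Lg0] : exists g, g \in L.
  by apply/set0Pn; apply: contraTneq ltL => ->; rewrite cards0 muln0.
apply/eqP; rewrite eqEsubset subsetT -indexg_eq1 /=.
have pU : p.-nat #|[set: gT] : <<U>>|.
  by apply: pnat_dvd pG; exact: dvdn_indexg.
have leL : #|L| <= #|<<U>>|.
  rewrite -(card_rcoset <<U>>%g g0); apply/subset_leq_card/subsetP => g Lg.
  by rewrite mem_rcoset mem_gen //; apply/imset2P; exists g g0.
have ltU : #|[set: gT] : <<U>>| < p.
  have := Lagrange (subsetT <<U>>); move: ltL leL.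
  set a := #|_ : _|; set b := #|<<U>>|; set c := #|L| => h1 h2 h3.
  rewrite ltnNge; apply/negP => pa; move: h1; rewrite -h3 ltnNge mulnC.
  by rewrite leq_mul.
case/p_natP: pU ltU => // -[->//|k ->] /=.
by rewrite expnS ltnNge leq_pmulr // expn_gt0 prime_gt0.
Qed.

Lemma exists_large_class (T I : finType) (L : I -> {set T}) :
  0 < #|T| -> (forall x, exists i, x \in L i) ->
  exists i, #|T| <= #|I| * #|L i|.
Proof.
move=> T0 cov; case: (pickP (fun i => #|T| <= #|I| * #|L i|)) => [i|lt].
  by exists i.
have [x _] := card_gt0P T0; have [i0 _] := cov x.
have leT : #|T| <= \sum_i #|L i|.
  have <- : #|\bigcup_i L i| = #|T|.
    apply: eq_card => z; rewrite !inE; apply/bigcupP.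
    by have [i] := cov z; exists i.
  apply: (big_rec2 (fun (A : {set T}) n => #|A| <= n)) => [|i A n _ le].
    by rewrite cards0.
  by apply: leq_trans (leq_card_setU _ _) _; rewrite leq_add2l.
have : #|I| * \sum_i #|L i| <= \sum_(i : I) #|T|.-1.
  rewrite big_distrr /=; apply: leq_sum => i _.
  by rewrite -ltnS prednK // ltnNge; apply/negbT; exact: lt.
rewrite sum_nat_const leq_pmul2l; last by apply/card_gt0P; exists i0.
by move=> /(leq_trans leT); rewrite -ltnS prednK // ltnn.
Qed.

(** Let L i be the set of the k in K whose conjugate of s i lies in H. These sets
cover K, and the largest one is large enough for its quotients u = g h^-1 to
generate K. For g, h in L i, the product of the conjugates of s i by g and of its
inverse by h lies in H. As K commutes with its own conjugate by s i, this product is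
u times an element of that conjugate, and in the other order it is u times an
element of the conjugate by the inverse of s i. So u normalizes the intersection
of H and K; and for two such u and v, the commutator of the element over u of
the first kind and of the element over v of the second kind is [u, v], since the
other factors commute. Thus K is abelian modulo H. *)
Lemma der1_sub_of_displacement (gT : finGroupType) (Gamma : groupType)
    (kap : gT -> Gamma) (H : {pred Gamma}) (I : finType)
    (s : I -> Gamma) p :
  {morph kap : g h / g * h} ->
  group_closed H -> prime p -> p.-group [set: gT] -> #|I| < p ->
  (forall i g h, commute (kap g) (kap h ^ s i)) ->
  (forall i g h, commute (kap g ^ s i) (kap h ^ (s i)^-1)) ->
  (forall k, exists i, s i ^ (kap k) \in H) ->
  forall k, k \in [set: gT]^`(1) -> kap k \in H.
Proof.
move=> kapM HG p_pr pG ltIp c1 c2 cov.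
have kap1 : kap 1 = 1 := morph_one kapM.
have kapV g : kap g^-1 = (kap g)^-1 := morph_inv kapM g.
have [H1 _] := HG; have HM := group_closedM HG; have HV := group_closedV HG.
pose L i := [set k | s i ^ kap k^-1 \in H].
have c3 i g h : commute (kap g) (kap h ^ (s i)^-1).
  have := congr1 (conjg^~ (s i)^-1) (c1 i h g).
  by rewrite /= !(conjMg (kap h)) (conjMg (kap g ^ s i)) !conjgK => /commute_sym.
have [i Li] : exists i, (#|gT| <= #|I| * #|L i|)%N.
  apply: exists_large_class => [|k]; first by apply/card_gt0P; exists 1.
  by have [i Hi] := cov k^-1; exists i; rewrite inE.
pose U := [set g * h^-1 | g in L i, h in L i].
have genU : <<U>> = [set: gT].
  have gT0 : (0 < #|gT|)%N by apply/card_gt0P; exists 1.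
  apply: gen_ldiv_of_large p_pr pG _; rewrite cardsT (leq_ltn_trans Li) //.
  by rewrite ltn_pmul2r // lt0n; apply: contraTneq Li => ->; rewrite muln0 -ltnNge.
have mulLR (x c y : Gamma) : commute y c -> x * c * y = x * y * c.
  by move=> yc; rewrite -!mulgA yc.
have idU u : u \in U ->
   (exists v, kap u * kap v ^ (s i)^-1 \in H) /\
   (exists v, kap u * kap v ^ s i \in H).
  case/imset2P => g h; rewrite !inE => Hg Hh ->.
  split; exists (g^-1 * h).
  - have -> : kap (g * h^-1) * kap (g^-1 * h) ^ (s i)^-1 =
        s i ^ kap g^-1 * (s i ^ kap h^-1)^-1.
      rewrite kapM -mulLR // !conjgE !kapM !kapV !invgM !invgK.
      by rewrite !gnorm.
    by apply: HM Hg (HV _ Hh).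
  - have -> : kap (g * h^-1) * kap (g^-1 * h) ^ s i =
        (s i ^ kap g^-1)^-1 * s i ^ kap h^-1.
      rewrite kapM -mulLR // !conjgE !kapM !kapV !invgM !invgK.
      by rewrite !gnorm.
    by apply: HM (HV _ Hg) Hh.
pose M := [set k | kap k \in H].
have MG : group_set M.
  apply/group_setP; split=> [|g h]; rewrite !inE ?kap1 //.
  by rewrite kapM; exact: HM.
have conjU u c : (forall g, commute (kap g) c) -> forall k, kap k ^ (kap u * c) = kap (k ^ u).
  move=> cc k; rewrite conjgM (_ : kap k ^ kap u = kap (k ^ u)).
    by rewrite conjgE cc mulKg.
  by rewrite !conjgE !kapM kapV.
have nMU : U \subset 'N(M).
  apply/subsetP => u /idU[[v Hv] _]; rewrite inE.
  apply/subsetP => _ /imsetP[k /[!inE] Hk ->]; rewrite -(conjU u (kap v ^ (s i)^-1)) // conjgE.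
  by apply: HM (HM _ _ _ _); rewrite ?HV.
pose MH := Group MG.
have nM : [set: gT] \subset 'N(MH) by rewrite -genU gen_subG.
have abU : abelian ([set: gT] / MH).
  rewrite -genU quotient_gen // abelian_gen.
  apply/centsP => _ /morphimP[u nu Uu ->] _ /morphimP[v nv Uv ->].
  have [[a Ha] _] := idU _ Uu; have [_ [b Hb]] := idU _ Uv.
  apply/commgP; rewrite -morphR //=; apply/eqP/coset_id; rewrite inE.
  set x := kap u * _ in Ha; set y := kap v * _ in Hb.
  suff -> : kap [~ u, v] = [~ x, y].
    by apply: HM (HV _ Ha) (HM _ _ (HV _ Hb) (HM _ _ Ha Hb)).
  have ax g : commute (kap g) (kap a ^ (s i)^-1) by [].
  have xy : x ^ y = kap (u ^ v) * kap a ^ (s i)^-1.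
    have ay : commute (kap a ^ (s i)^-1) y.
      by apply: commuteM; [exact: commute_sym | exact: commute_sym (c2 _ _ _)].
    by rewrite [LHS]conjMg conjU // [in X in _ * X]conjgE ay mulKg.
  rewrite [RHS]commgEl xy /x; move: (kap a ^ _) (ax) => c cx.
  rewrite invgM -mulgA (mulgA _ _ c) -kapV -kapM -commgEl.
  by rewrite cx mulKg.
have /subsetP sub : [set: gT]^`(1) \subset MH.
  by apply: der1_min; [exact: nM | exact: abU].
by move=> k /sub; rewrite inE.
Qed.

End Displacement.

(** * A wandering box for Z^n *)

Definition prefix_map1 D (a : cantor_space -> cantor_space) :=
  forall v, (D <= size v)%N -> exists w, forall y, a (prepend v y) = prepend w y.

(** The hyperbolic element of V with the table 0 -> 00, 10 -> 01, 11 -> 1: it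
attracts to the sequence of zeros and repels from the sequence of ones. *)
Definition stretch (x : cantor_space) : cantor_space :=
  if x 0%N then (if x 1%N then tail 1 x else prepend [:: false; true] (tail 2 x))
  else prepend [:: false] x.

Definition shrink (x : cantor_space) : cantor_space :=
  if x 0%N then prepend [:: true] x
  else (if x 1%N then prepend [:: true; false] (tail 2 x) else tail 1 x).

Lemma stretchK : cancel stretch shrink.
Proof.
move=> x; apply/funext => k; rewrite /stretch /shrink /prepend /tail /=.
case x0 : (x 0%N); case x1 : (x 1%N) => /=; rewrite ?addn1 ?x0 ?x1 /=;
  case: k => [|[|k]] /=; rewrite ?x0 ?x1 ?subn0 ?subn1 ?subn2 ?add1n ?add2n //=.
Qed.

Lemma shrinkK : cancel shrink stretch.
Proof.
move=> x; apply/funext => k; rewrite /stretch /shrink /prepend /tail /=.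
case x0 : (x 0%N); case x1 : (x 1%N) => /=; rewrite ?addn1 ?x0 ?x1 /=;
  case: k => [|[|k]] /=; rewrite ?x0 ?x1 ?subn0 ?subn1 ?subn2 ?add1n ?add2n //=.
Qed.

(** Each iteration reads two letters and leaves at least one, so 2k letters
suffice for k iterations. *)
Lemma prefix_map1_iter a (r : bool -> bool -> seq bool) k :
  (forall b c, 0 < size (r b c))%N ->
  (forall b c z, a (prepend [:: b; c] z) = prepend (r b c) z) ->
  prefix_map1 k.*2 (iter k a).
Proof.
move=> r0 aE; elim: k => [|k IH] v; first by exists v.
rewrite doubleS; case: v => [|b [|c v]] //= le.
have [|w wE] := IH (r b c ++ v).
  by rewrite size_cat; have := r0 b c; lia.
exists w => y; rewrite -iterS iterSr -wE -[b :: _]/([:: b; c] ++ v).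
by rewrite !prepend_cat aE.
Qed.

Lemma stretch_prefix k : prefix_map1 k.*2 (iter k stretch).
Proof.
apply: (@prefix_map1_iter _ (fun b c =>
  if b then (if c then [:: true] else [:: false; true]) else [:: false; false; c])).
  by case; case.
move=> [] [] z; apply/funext => i; rewrite /stretch /prepend /tail /=;
  by case: i => [|[|[|i]]] //=; rewrite ?subn0 ?subn1 ?subn2 ?subSS ?add1n ?add2n ?subn0.
Qed.

Lemma shrink_prefix k : prefix_map1 k.*2 (iter k shrink).
Proof.
apply: (@prefix_map1_iter _ (fun b c =>
  if b then [:: true; true; c] else (if c then [:: true; false] else [:: false]))).
  by case; case.
move=> [] [] z; apply/funext => i; rewrite /shrink /prepend /tail /=;
  by case: i => [|[|[|i]]] //=; rewrite ?subn0 ?subn1 ?subn2 ?subSS ?add1n ?add2n ?subn0.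
Qed.

(** A fundamental domain for [stretch]: its image is the cylinder 01, and all
its further images lie in the cylinder 0. *)
Definition window10 (x : cantor_space) := x 0%N && ~~ x 1%N.

Lemma iter_stretch_window10 k x : window10 x -> iter k.+1 stretch x 0%N = false.
Proof.
move=> /andP[x0 /negPf x1]; elim: k => [|k IH]; first by rewrite /= /stretch x0 x1.
by rewrite iterS {1}/stretch IH.
Qed.

Lemma iterK (T : Type) (f g : T -> T) k : cancel f g -> cancel (iter k f) (iter k g).
Proof. by move=> fK x; elim: k => // k IH; rewrite iterSr iterS fK. Qed.

Lemma iter_stretch_wander k l x y : window10 x -> window10 y ->
  iter k stretch x = iter l stretch y -> k = l.
Proof.
wlog le : k l x y / (k <= l)%N => [th wx wy e|wx wy].
  by case: (leqP k l) => [|/ltnW] kl; [exact: th kl wx wy e|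
    exact/esym/(th _ _ _ _ kl wy wx (esym e))].
rewrite -(subnKC le) iterD => /(can_inj (iterK k stretchK)) xE.
move: (l - k)%N xE => d; case: d => [|d] xE; first by rewrite addn0.
by move: wx; rewrite /window10 xE iter_stretch_window10.
Qed.

Section Translations.
Variable n : nat.
Local Notation cube := (cantor_cube n).

Lemma prefix_map_coordinatewise D (F : 'I_n -> cantor_space -> cantor_space) :
  (forall j, prefix_map1 (D j) (F j)) ->
  prefix_map (\max_j D j) (fun (x : cube) j => F j (x j)).
Proof.
move=> FD v vD; have /choice[w wE] : forall j, exists w, forall y,
    F j (prepend (v j) y) = prepend w y.
  by move=> j; apply: FD; apply: leq_trans (vD j); exact: (leq_bigmax j).
exists w => y; apply: functional_extensionality_dep => j.
by rewrite /prepends wE.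
Qed.

Lemma translation_sig (e : 'I_n -> nat) : {g : brin_thompson n |
  g =1 (fun x j => iter (e j) stretch (x j)) :> (cube -> cube)}.
Proof.
have h1 := prefix_map_coordinatewise (fun j => @stretch_prefix (e j)).
have h2 := prefix_map_coordinatewise (fun j => @shrink_prefix (e j)).
apply: brin_thompson_of_prefix_map h1 h2 => x; apply: functional_extensionality_dep => j.
- by rewrite iterK //; exact: stretchK.
- by rewrite iterK //; exact: shrinkK.
Qed.

(** The action on the n-cube of a vector of natural numbers e in the lattice Z^n;
a general element of the lattice is a quotient of two of them. *)
Definition translation e := sval (translation_sig e).

Lemma translationE e x j : translation e x j = iter (e j) stretch (x j).
Proof. by rewrite /translation; case: (translation_sig e) => g /= ->. Qed.

Lemma translationD e e' :
  translation (fun j => e j + e' j)%N = (translation e * translation e')%g.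
Proof.
apply: brin_thompson_ext => x; apply: functional_extensionality_dep => j.
by rewrite brin_thompsonM_apply !translationE iterD.
Qed.

Lemma translation_adjacent (e e' : 'I_n -> nat) :
  (forall i, e i <= (e' i).+1 /\ e' i <= (e i).+1)%N ->
  exists u u' : {ffun 'I_n -> bool}, translation e' =
    ((translation (fun j => u j : nat))^-1 * translation (fun j => u' j : nat)
     * translation e)%g.
Proof.
move=> adj; exists [ffun j => e' j < e j]%N, [ffun j => e j < e' j]%N.
apply: (@mulgI _ (translation (fun j => [ffun j => e' j < e j]%N j : nat))).
rewrite !mulgA mulgV mul1g -!translationD; congr translation; apply/funext => j.
by rewrite !ffunE; have := adj j; lia.
Qed.

(** The wandering box of the lattice, the product of the cylinders 10. *)
Definition core (x : cube) := [forall j, window10 (x j)].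

Lemma core_wandering e e' x y : core x -> core y ->
  translation e x = translation e' y -> e = e'.
Proof.
move=> /forallP cx /forallP cy exy; apply/funext => j.
apply: iter_stretch_wander (cx j) (cy j) _.
by rewrite -!translationE exy.
Qed.

Definition supported (P : pred cube) (g : brin_thompson n) := forall x, ~~ P x -> g x = x.

Lemma supportedJ P g (s : brin_thompson n) :
  supported P g -> supported (fun x => P (s x)) (g ^ s)%g.
Proof.
move=> gP x nP; rewrite conjgE !brin_thompsonM_apply gP //.
exact: brin_thompsonK.
Qed.

Lemma supported_stable P g x : supported P g -> P x -> P (g x).
Proof.
move=> gP Px; apply: contraT => ngx.
have := gP _ ngx; move/(can_inj (brin_thompsonK g)) => gx.
by rewrite gx Px in ngx.
Qed.

Lemma disjoint_commute P Q g h : supported P g -> supported Q h ->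
  (forall x, P x -> Q x -> False) -> commute g h.
Proof.
move=> gP hQ PQ; apply: brin_thompson_ext => x; rewrite !brin_thompsonM_apply.
have nQ z : P z -> ~~ Q z by move=> Pz; apply/negP; exact: PQ.
have [Px|nPx] := boolP (P x).
  by rewrite !(hQ x, hQ (g x)) // nQ // supported_stable.
rewrite (gP x) //; have [Qx|nQx] := boolP (Q x); last by rewrite hQ // gP.
by rewrite gP //; apply: contraL (supported_stable hQ Qx) => /nQ.
Qed.

Lemma core_disjoint e e' x : e <> e' -> core x ->
  core (((translation e')^-1 * translation e)%g x) -> False.
Proof.
move=> ee' cx cy; apply: ee'; apply: core_wandering cx cy _.
by rewrite brin_thompsonM_apply brin_thompsonVK.
Qed.

Lemma translationC e e' : commute (translation e) (translation e').
Proof.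
by rewrite /commute -!translationD; congr translation; apply/funext => j; rewrite addnC.
Qed.

(** The translates of the core by s and by its inverse differ by the square of s,
which translates by 2 (e - e'). *)
Lemma core_disjoint2 e e' x (s := ((translation e')^-1 * translation e)%g) :
  e <> e' -> core (s x) -> core ((s^-1)%g x) -> False.
Proof.
move=> ee' csx csVx; set y := (s^-1)%g x in csVx.
have xE : x = s y by rewrite brin_thompsonVK.
suff e2 : (fun j => e j + e j)%N = (fun j => e' j + e' j)%N.
  by apply: ee'; apply/funext => j; have := congr1 (@^~ j) e2; lia.
apply: core_wandering csVx csx _; rewrite xE !translationD.
rewrite -!brin_thompsonM_apply.
suff -> : (translation e * translation e = translation e' * translation e' * s * s)%g by [].
rewrite /s !mulgA mulgK -(mulgA _ _ (translation e)) (translationC e' e).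
by rewrite !mulgA mulgK.
Qed.
End Translations.

(** * Finite groups supported in the box *)

Section BlockAction.
Variable gT : finGroupType.

(** One word of length #|K| for each element of the group K, with a single letter
1 in the place of the element. The group acts on these words by left
translation, and hence on the sequences which begin with one of them. *)
Definition block_word (h : gT) : seq bool := mkseq (eq_op (enum_rank h : nat)) #|gT|.

Lemma size_block_word h : size (block_word h) = #|gT|.
Proof. by rewrite size_mkseq. Qed.

Lemma block_word_inj : injective block_word.
Proof.
move=> g h /(congr1 (nth false ^~ (enum_rank g))).
rewrite !nth_mkseq // eqxx => /esym/eqP e.
by apply/enum_rank_inj/ord_inj.
Qed.

Definition block_act (g : gT) (u : seq bool) : seq bool :=
  if [pick h | block_word h == u] is Some h then block_word (g * h)%g else u.

Lemma block_act_word g h : block_act g (block_word h) = block_word (g * h)%g.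
Proof.
rewrite /block_act; case: pickP => [k /eqP/block_word_inj -> //|/(_ h)].
by rewrite eqxx.
Qed.

Lemma size_block_act g u : size (block_act g u) = size u.
Proof. by rewrite /block_act; case: pickP => // h /eqP <-; rewrite !size_block_word. Qed.

Lemma block_actM g h u : block_act (g * h) u = block_act g (block_act h u).
Proof.
rewrite {1 3}/block_act; case: pickP => [k _|uN]; first by rewrite block_act_word mulgA.
by rewrite /block_act; case: pickP => // k; rewrite uN.
Qed.

Lemma block_act1 u : block_act 1 u = u.
Proof. by rewrite /block_act; case: pickP => // k /eqP <-; rewrite mul1g. Qed.

Definition block_map g (x : cantor_space) : cantor_space :=
  prepend (block_act g (window #|gT| x)) (tail #|gT| x).

Lemma block_mapM g h x : block_map (g * h) x = block_map g (block_map h x).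
Proof.
rewrite /block_map block_actM; set u := block_act h _.
have su : size u = #|gT| by rewrite size_block_act size_mkseq.
by rewrite window_prepend ?su // -{3}su tail_prepend_size take_oversize ?su.
Qed.

Lemma block_map1 x : block_map 1 x = x.
Proof. by rewrite /block_map block_act1 prepend_window. Qed.

Lemma block_map_prefix g : prefix_map1 #|gT| (block_map g).
Proof.
move=> v vT; exists (block_act g (take #|gT| v) ++ drop #|gT| v) => y.
by rewrite /block_map window_prepend // tail_prepend_drop // prepend_cat.
Qed.

Variables (n : nat) (j0 : 'I_n).
Local Notation cube := (cantor_cube n).

(** The action takes place on the coordinate j0, behind the prefix 10, for the
points all of whose coordinates lie in the cylinder 10. *)
Definition core_block_map g (x : cube) : cube := fun j =>
  if core x && (j == j0) then prepend [:: true; false] (block_map g (tail 2 (x j)))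
  else x j.

Lemma core_core_block_map g x : core (core_block_map g x) = core x.
Proof.
rewrite /core_block_map; case cx : (core x); last exact: cx.
apply/forallP => j; case: ifP => // _.
by have /forallP := cx; apply.
Qed.

Lemma core_block_mapM g h x :
  core_block_map (g * h) x = core_block_map g (core_block_map h x).
Proof.
apply: functional_extensionality_dep => j.
rewrite [LHS]/core_block_map [RHS]/core_block_map core_core_block_map.
case: ifP => c; rewrite /core_block_map c //.
by rewrite (tail_prepend_size [:: true; false]) block_mapM.
Qed.

Lemma core_block_map1 x : core_block_map 1 x = x.
Proof.
apply: functional_extensionality_dep => j; rewrite /core_block_map.
case: ifP => // /andP[/forallP/(_ j) /andP[x0 /negPf x1] _].
by rewrite block_map1 -[RHS](prepend_window 2) /window /mkseq /= x0 x1.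
Qed.

Lemma core_block_map_prefix g : prefix_map #|gT|.+2 (core_block_map g).
Proof.
move=> v vT.
have coreE y : core (prepends v y) = [forall j, nth false (v j) 0 && ~~ nth false (v j) 1].
  apply: eq_forallb => j; have := vT j; rewrite /window10 /prepends /prepend.
  by case: (v j) => [|b [|c u]].
have [w wE] : exists w, forall y, block_map g (prepend (drop 2 (v j0)) y) = prepend w y.
  by apply: block_map_prefix; rewrite size_drop; have := vT j0; lia.
exists (fun j => if [forall j, nth false (v j) 0 && ~~ nth false (v j) 1] && (j == j0)
  then [:: true; false] ++ w else v j) => y.
apply: functional_extensionality_dep => j; rewrite /core_block_map coreE /prepends.
case: ifP => // /andP[_ /eqP ->]; rewrite prepend_cat -wE.
by rewrite tail_prepend_drop //; have := vT j0; lia.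
Qed.

Lemma core_block_sig g : {a : brin_thompson n | a =1 core_block_map g :> (cube -> cube)}.
Proof.
apply: brin_thompson_of_prefix_map (core_block_map_prefix g) (core_block_map_prefix g^-1) => x.
- by rewrite -core_block_mapM mulVg core_block_map1.
- by rewrite -core_block_mapM mulgV core_block_map1.
Qed.

Definition core_block g := sval (core_block_sig g).

Lemma core_blockE g x : core_block g x = core_block_map g x.
Proof. by rewrite /core_block; case: (core_block_sig g). Qed.

Lemma core_blockM : {morph core_block : g h / (g * h)%g}.
Proof.
move=> g h; apply: brin_thompson_ext => x.
by rewrite brin_thompsonM_apply !core_blockE core_block_mapM.
Qed.

Lemma core_block_supported g : supported (@core n) (core_block g).
Proof.
move=> x /negPf cx; rewrite core_blockE /core_block_map cx.
by apply: functional_extensionality_dep.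
Qed.

Lemma core_block_faithful g : core_block g = 1%g -> g = 1%g.
Proof.
move=> g1; pose x : cube := fun _ =>
  prepend [:: true; false] (prepend (block_word 1) (fun=> false)).
have cx : core x by apply/forallP => j.
have := congr1 (fun a : brin_thompson n => tail 2 (a x j0)) g1.
rewrite core_blockE /core_block_map cx eqxx /= (tail_prepend_size [:: true; false]).
have -> : tail 2 ((1%g : brin_thompson n) x j0) = prepend (block_word 1) (fun=> false).
  exact: (tail_prepend_size [:: true; false]).
rewrite /block_map window_prepend ?size_block_word // take_oversize ?size_block_word //.
rewrite block_act_word mulg1 => /(congr1 (window #|gT|)).
rewrite !window_prepend ?size_block_word // !take_oversize ?size_block_word //.
exact: block_word_inj.
Qed.
End BlockAction.

(** * The embedding theorem *)

(** The differences s i of the box are indexed by its pairs of distinct elements,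
and p exceeds their number. *)
Lemma no_embedding n m (f : brin_thompson n -> brin_thompson m) :
  {morph f : g h / (g * h)%g} -> injective f -> (m < n)%N -> False.
Proof.
move=> fM finj mn; have f1 := morph_one fM; have fV := morph_inv fM.
have j0 : 'I_n := Ordinal (leq_ltn_trans (leq0n m) mn).
pose b e := f (translation e).
pose U := {ffun 'I_n -> bool}.
pose step (u : U * U) := f ((translation (fun j => u.1 j : nat))^-1 *
  translation (fun j => u.2 j : nat))%g.
have [e e' adj|L coll] := @grid_orbit_collision m n b mn (map step (enum {: U * U})).
  have [u [u' uu']] := translation_adjacent adj.
  exists (f ((translation (fun j => u j : nat))^-1 * translation (fun j => u' j : nat))%g).
    by apply/mapP; exists (u, u'); rewrite ?mem_enum.
  by rewrite /b uu' fM.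
pose E := {ffun 'I_n -> 'I_L.+1}; pose I := {p : E * E | p.1 != p.2}.
pose tr (e : E) := translation (fun j => e j : nat).
pose s (i : I) := ((tr (val i).2)^-1 * tr (val i).1)%g.
have sne (i : I) : (fun j => (val i).1 j : nat) <> (fun j => (val i).2 j : nat).
  move=> e; have /eqP := valP i; apply; apply/ffunP => j; apply: ord_inj.
  exact: (congr1 (@^~ j) e).
have [p pI p_pr] := prime_above #|{: I}|.
have [K [pK nabK]] : exists K : finGroupType,
    (p.-group [set: K] /\ [set: K]^`(1) != 1)%g.
  exists p^{1+2}%type; have [[_ ->] pZ] := pX1p2_extraspecial p_pr.
  by rewrite pX1p2_pgroup // -cardG_gt1 prime_gt1.
pose kap := core_block (gT := K) j0.
have kap_s i g : supported (fun x => core (s i x)) (kap g ^ s i)%g.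
  by apply: supportedJ; exact: core_block_supported.
have kap_sV i g : supported (fun x => core ((s i)^-1 x)%g) (kap g ^ (s i)^-1)%g.
  by apply: supportedJ; exact: core_block_supported.
pose H y := [pred g : brin_thompson n | `[< f g y = y >]].
have inH y : group_closed (H y).
  have fE g h : f (g * h)%g y = f g (f h y) by rewrite fM.
  split=> [|g h /asboolP gy /asboolP hy]; apply/asboolP; first by rewrite f1.
  have hV : f h^-1%g y = y by rewrite -{1}hy -fE mulVg f1.
  by rewrite fE hV.
have stab y := @der1_sub_of_displacement K _ kap (H y) _ s p
  (core_blockM j0) (inH y) p_pr pK pI.
case/trivgPn: nabK => k kK /eqP; apply.
apply: (@core_block_faithful K n j0); apply: finj.
apply: brin_thompson_ext => y.
have /asboolP -> : kap k \in H y; last by rewrite f1.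
apply: stab kK => [i g h|i g h|g].
- apply: disjoint_commute (core_block_supported j0 g) (kap_s i h) _ => x.
  exact: core_disjoint.
- apply: disjoint_commute (kap_s i g) (kap_sV i h) _ => x.
  exact: core_disjoint2.
(* The conjugate of s i by kap g fixes y if and only if s i fixes the image of y. *)
have [e [e' [eL e'L ee' bb]]] := coll (f (kap g) y).
pose F (a : 'I_n -> nat) : E := [ffun j => inord (a j)].
have FE a : (forall j, a j <= L)%N -> (fun j => F a j : nat) = a.
  by move=> aL; apply/funext => j; rewrite ffunE inordK // ltnS.
have Fne : F e != F e'.
  by apply/eqP => FF; apply: ee'; rewrite -(FE e) // -(FE e') // FF.
exists (exist _ (F e, F e') Fne); apply/asboolP.
rewrite /s /tr /= !FE // conjgE !fM !fV !brin_thompsonM_apply.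
by rewrite bb !brin_thompsonK.
Qed.

Section CoordinateExtension.
Variables (n m : nat) (nm : (n <= m)%N).

Definition first_coords (A : Type) (x : 'I_m -> A) : 'I_n -> A :=
  fun i => x (widen_ord nm i).

Definition set_first_coords (A : Type) (y : 'I_n -> A) (x : 'I_m -> A) : 'I_m -> A :=
  fun j => if insub (j : nat) is Some i then y i else x j.

Lemma first_coords_set A (y : 'I_n -> A) x : first_coords (set_first_coords y x) = y.
Proof.
by apply/funext => i; rewrite /first_coords /set_first_coords /= valK.
Qed.

Lemma set_first_coords_set A (y z : 'I_n -> A) x :
  set_first_coords y (set_first_coords z x) = set_first_coords y x.
Proof. by apply/funext => j; rewrite /set_first_coords; case: insubP. Qed.

Lemma set_first_coordsK A (x : 'I_m -> A) : set_first_coords (first_coords x) x = x.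
Proof.
apply/funext => j; rewrite /set_first_coords; case: insubP => // i _ ij.
by congr x; apply: ord_inj.
Qed.

Definition extend (f : cantor_cube n -> cantor_cube n) (x : cantor_cube m) : cantor_cube m :=
  set_first_coords (f (first_coords x)) x.

Lemma extend_comp f g x : extend f (extend g x) = extend (f \o g) x.
Proof. by rewrite /extend first_coords_set set_first_coords_set. Qed.

Lemma extend_prefix_map D f : prefix_map D f -> prefix_map D (extend f).
Proof.
move=> fD v vD; have [i|w wE] := fD (first_coords v); first exact: vD.
exists (set_first_coords w v) => y; rewrite /extend.
have -> : first_coords (prepends v y) = prepends (first_coords v) (first_coords y) by [].
rewrite wE; apply/funext => j; rewrite /prepends /set_first_coords.
by case: insubP => // i _ ij; congr (prepend _ _); rewrite /first_coords; congr y; apply: ord_inj.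
Qed.

Lemma extend_sig (g : brin_thompson n) : {h : brin_thompson m |
  h =1 extend g :> (cantor_cube m -> cantor_cube m)}.
Proof.
have /cid[D gD] := brin_thompson_prefix_map (brin_thompsonP g).
have /cid[D' gD'] := brin_thompson_prefix_map (brin_thompsonP g^-1%g).
apply: brin_thompson_of_prefix_map (extend_prefix_map gD) (extend_prefix_map gD').
- move=> x; rewrite extend_comp (_ : _ \o _ = id); first exact: set_first_coordsK.
  by apply/funext => y; exact: (brin_thompsonK g).
- move=> x; rewrite extend_comp (_ : _ \o _ = id); first exact: set_first_coordsK.
  by apply/funext => y; exact: (brin_thompsonVK g).
Qed.

Definition extend_brin_thompson g := sval (extend_sig g).

Lemma extend_brin_thompsonE g x : extend_brin_thompson g x = extend g x.
Proof. by rewrite /extend_brin_thompson; case: (extend_sig g). Qed.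

Lemma extend_brin_thompsonM :
  {morph extend_brin_thompson : g h / (g * h)%g >-> (g * h)%g}.
Proof.
move=> g h; apply: brin_thompson_ext => x.
by rewrite brin_thompsonM_apply !extend_brin_thompsonE extend_comp.
Qed.

HB.instance Definition _ :=
  isMultiplicative.Build _ _ extend_brin_thompson extend_brin_thompsonM.

Lemma extend_brin_thompson_inj : injective extend_brin_thompson.
Proof.
move=> g h gh; apply: brin_thompson_ext => y.
pose x : cantor_cube m := set_first_coords y (fun=> fun=> false).
have := congr1 (fun a : brin_thompson m => first_coords (a x)) gh.
by rewrite !extend_brin_thompsonE /extend !first_coords_set.
Qed.

End CoordinateExtension.

Theorem corollary1p11 (n m : nat) (hn : (0 < n)%N) (hm : (0 < m)%N) :
  (exists f : {multiplicative brin_thompson n -> brin_thompson m},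
     injective f) <-> (n <= m)%N.
Proof.
split=> [[f finj]|nm]; last first.
  by exists (extend_brin_thompson nm); exact: extend_brin_thompson_inj.
rewrite leqNgt; apply/negP => mn.
apply: (@no_embedding n m f) => // g h; exact: gmulfM.
Qed.
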